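(* For every integer $d \geq 2$, $L_d \geq L^\circ_d \geq 2^{3 \cdot 2^{\lfloor d/2 \rfloor - 1} - 1}$.
   Context: For $a,b \in \mathbb{N}$ write $a \rightarrow b$ iff either $b = a+1$ or $b = 0$. For vectors $v,w \in \mathbb{N}^d$ write $v \rightarrow w$ iff $v^\ell \rightarrow w^\ell$ for every coordinate $\ell$, and $v \leq w$ iff $v^\ell \leq w^\ell$ for every coordinate $\ell$. A sequence $(v_0,\ldots,v_{n-1})$ of vectors in $\mathbb{N}^d$ is valid iff $v_i \rightarrow v_{i+1}$ for each $i < n-1$; it is cyclic iff it is valid and additionally $v_{n-1} \rightarrow v_0$. A sequence is non-dominating iff $v_i \not\leq v_j$ whenever $i < j$. $L_d$ denotes the maximum length of a non-dominating valid sequence of vectors in $\mathbb{N}^d$, and $L^\circ_d$ denotes the maximum length of a non-dominating cyclic sequence of vectors in $\mathbb{N}^d$. *)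

(* Defs.v *)
From mathcomp Require Import all_boot.
From mathcomp Require Import boolp classical_sets.

Set Implicit Arguments.
Unset Strict Implicit.
Unset Printing Implicit Defensive.

Definition vec (d : nat) := {ffun 'I_d -> nat}.

Definition step (a b : nat) : bool := (b == a.+1) || (b == 0).

Definition vstep (d : nat) (v w : vec d) : bool :=
  [forall l, step (v l) (w l)].

Definition vle (d : nat) (v w : vec d) : bool := [forall l, v l <= w l].

Definition valid (d : nat) (s : seq (vec d)) : bool := sorted (@vstep d) s.

(* [cycle] is validity together with the closing step from the last vector
   back to the first one. *)
Definition cyclic (d : nat) (s : seq (vec d)) : bool := cycle (@vstep d) s.

(* [pairwise] only compares an entry with strictly later ones. *)
Definition non_dominating (d : nat) (s : seq (vec d)) : bool :=
  pairwise (fun v w => ~~ vle v w) s.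

Definition is_max_length (T : Type) (P : pred (seq T)) (n : nat) : Prop :=
  (exists2 s, P s & size s = n) /\ (forall s, P s -> size s <= n).

(* The maximum is unique when it exists; the value is 0 when it does not, so a
   positive lower bound on [max_length P] entails that the maximum exists. *)
Definition max_length (T : Type) (P : pred (seq T)) : nat :=
  xget 0 [set n | is_max_length P n]%classic.

Definition L (d : nat) : nat :=
  max_length (fun s : seq (vec d) => valid s && non_dominating s).

Definition Lcirc (d : nat) : nat :=
  max_length (fun s : seq (vec d) => cyclic s && non_dominating s).

(* Main.v *)
(** Upper bound: restrict the comparison of vectors to a set of coordinates [S].
    A window of steps in which a coordinate of [S] is never reset is still
    non-dominating with respect to [S] minus that coordinate, so its length is
    bounded by induction on the cardinality of [S]. Hence, after a bounded prefix,
    all coordinates in [S] are bounded, and the remaining vectors are pairwise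
    distinct on [S].

    Lower bound: a cyclic non-dominating sequence of length [n] is repeated [2n]
    times, with two new counters. Each counter is reset in every other round, at
    position 0 and once more at a position that increases by one each time; the
    rounds of resets of the two counters alternate. In every round the counter
    that is not reset is larger than it ever is at the same or an earlier position
    of a later round. This gives length [2n^2] with two more coordinates. *)

Require Import Defs.
From mathcomp Require Import all_boot.
From mathcomp Require Import boolp classical_sets zify.

Lemma max_lengthP (T : Type) (P : pred (seq T)) (B : nat) :
  (exists s, P s) -> (forall s, P s -> size s <= B) ->
  is_max_length P (max_length P).
Proof.
move=> [s0 Ps0] leB.
pose Q n := `[< exists2 s, P s & size s = n >].
have exQ : exists n, Q n by exists (size s0); apply/asboolP; exists s0.
have ubQ n : Q n -> n <= B by move=> /asboolP[s Ps <-]; exact: leB.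
apply: (@xgetPex _ 0 [set n | is_max_length P n]%classic).
case: (ex_maxnP exQ ubQ) => m /asboolP Qm maxm; exists m; split=> // s Ps.
by apply: maxm; apply/asboolP; exists s.
Qed.

(** After a reset at time [k] the value is at most the number of steps since then. *)
Lemma iter_step (a : nat -> nat) (n : nat) :
  (forall i, i < n -> step (a i) (a i.+1)) -> (exists2 k, k <= n & a k = 0) ->
  a n <= n.
Proof.
move=> st [k le_kn ak0].
suff H i : k <= i <= n -> a i <= i by apply: H; rewrite le_kn leqnn.
elim: i => [|i IHi]; first by rewrite leqn0 => /andP[/eqP<- _]; rewrite ak0.
case: (eqVneq k i.+1) => [<- _|neq_ki ki_n]; first by rewrite ak0.
have := st i; rewrite /step; move: IHi; lia.
Qed.

(** [B] is chosen before [S], [v] and [N], so the induction hypothesis covers every window and every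
    [S :\ l]. *)
Lemma non_dominating_bound (d n : nat) :
  exists B, forall (S : {set 'I_d}) (v : nat -> 'I_d -> nat) (N : nat),
    #|S| = n ->
    (forall i l, i.+1 < N -> step (v i l) (v i.+1 l)) ->
    (forall i j, i < j < N -> exists2 l, l \in S & v j l < v i l) ->
    N <= B.
Proof.
elim: n => [|n [B IH]].
  exists 1 => S v N /eqP; rewrite cards_eq0 => /eqP -> _ nd.
  rewrite leqNgt; apply/negP => N1.
  by have [] := nd 0 1 N1 => l; rewrite inE.
exists (B + #|{ffun 'I_d -> 'I_B.+1}|) => S v N cardS st nd.
have small i l : l \in S -> B <= i < N -> v i l <= B.
  move=> lS /andP[leBi ltiN].
  pose a k := v (i - B + k) l.
  have -> : v i l = a B by rewrite /a subnK.
  apply: iter_step => [k ltkB|]; first by rewrite /a addnS; apply: st; lia.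
  apply: contrapT => noreset.
  have a_mono j k : j <= k <= B -> a j <= a k.
    elim: k => [|k IHk]; first by rewrite leqn0 => /andP[/eqP->].
    case: (eqVneq j k.+1) => [-> //|jk jkB].
    have /IHk le_jk : j <= k <= B by lia.
    have : step (a k) (a k.+1) by rewrite /a addnS; apply: st; lia.
    rewrite /step => /orP[/eqP->|/eqP ak0]; first by lia.
    by case: noreset; exists k.+1 => //; lia.
  have cardSl : #|S :\ l| = n by have := cardsD1 l S; rewrite lS cardS; lia.
  (* The window has [B.+1] vectors, one more than [IH] allows; as [l] never decreases on it,
     [S :\ l] suffices. *)
  suff : B < B by rewrite ltnn.
  apply: (IH _ (fun k => v (i - B + k)) _ cardSl) => [k l' kB|j k jk].
    by rewrite addnS; apply: st; lia.
  have [|l' l'S lt] := nd (i - B + j) (i - B + k); first by lia.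
  exists l' => //; rewrite !inE l'S andbT; apply: contraTneq lt => ->.
  by rewrite -leqNgt; apply: a_mono; lia.
rewrite -leq_subLR.
(* Coordinates outside [S] may be unbounded and are set to 0; on [S], [small] makes [inord]
   lossless. *)
pose f i := [ffun l : 'I_d => inord (if l \in S then v (B + i) l else 0) : 'I_B.+1].
suff /card_uniqP Ef : uniq (mkseq f (N - B)) by rewrite -(size_mkseq f (N - B)) -Ef max_card.
rewrite map_inj_in_uniq ?iota_uniq // => i j; rewrite !mem_iota !add0n /= => iN jN.
wlog ltij : i j iN jN / i < j => [H fij|].
  by case: (ltngtP i j) => // ij; [apply: H | apply/esym/H].
move=> /ffunP fij; have [|l lS] := nd (B + i) (B + j); first by lia.
have /(congr1 val) := fij l; rewrite !ffunE lS /= !inordK ?ltnS.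
- by move=> ->; rewrite ltnn.
- by apply: small => //; lia.
- by apply: small => //; lia.
Qed.

Lemma size_valid_non_dominating (d : nat) :
  exists B, forall s : seq (vec d), valid s && non_dominating s -> size s <= B.
Proof.
have [B HB] := non_dominating_bound d d; exists B => s /andP[val nd].
pose x0 : vec d := [ffun=> 0].
apply: (HB [set: 'I_d] (nth x0 s)) => [|i l lt|i j /andP[ij js]].
- by rewrite cardsT card_ord.
- by move: val => /(sortedP x0)/(_ i lt)/forallP.
- move: nd => /(pairwiseP x0)/(_ i j (ltn_trans ij js) js ij).
  by rewrite negb_forall => /existsP[l]; rewrite -ltnNge => ?; exists l; rewrite ?inE.
Qed.

Lemma cyclic_valid (d : nat) (s : seq (vec d)) : cyclic s -> valid s.
Proof. by case: s => //= x s; rewrite /cyclic /= rcons_path => /andP[]. Qed.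

(* Coordinates are indexed by all of [nat]; only the first [d] count for
   non-domination. *)
Definition cyclic_run (d n : nat) (v : nat -> nat -> nat) : Prop :=
  (forall i l, i < n -> step (v i l) (v (i.+1 %% n) l)) /\
  (forall i j, i < j < n -> exists2 l, l < d & v j l < v i l).

(** Allowing [m < d] serves odd dimensions: further coordinates cannot create domination. *)
Lemma cyclic_run_seq (d m n : nat) (v : nat -> nat -> nat) :
  m <= d -> cyclic_run m n v ->
  exists2 s : seq (vec d), cyclic s && non_dominating s & size s = n.
Proof.
move=> md [st nd]; pose f i : vec d := [ffun l : 'I_d => v i l].
exists (mkseq f n); last by rewrite size_mkseq.
apply/andP; split.
  case: n st {nd} => // n st; rewrite /cyclic /=.
  apply/(pathP (f 0)) => i; rewrite size_rcons size_map size_iota => lti.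
  rewrite -rcons_cons !nth_rcons /= size_map size_iota lti.
  have -> : nth (f 0) (f 0 :: [seq f j | j <- iota 1 n]) i = f i.
    by rewrite -[_ :: _]/(mkseq f n.+1) nth_mkseq.
  have -> : (if i < n then nth (f 0) [seq f j | j <- iota 1 n] i
             else if i == n then f 0 else f 0) = f (i.+1 %% n.+1).
    case: (ltnP i n) => ltin; last first.
      by have -> : i = n by [lia]; rewrite eqxx modnn.
    by rewrite (nth_map 0) ?size_iota // nth_iota // modn_small.
  by apply/forallP => l; rewrite !ffunE; apply: st.
apply/(pairwiseP (f 0)) => i j; rewrite !inE size_mkseq => iN jN ij.
rewrite !nth_mkseq // negb_forall; apply/existsP.
have [|l ltl lt] := nd i j; first by rewrite ij.
by exists (Ordinal (leq_trans ltl md)); rewrite !ffunE -ltnNge.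
Qed.

(* [n] is the length of a round; the counter is reset at position 0 of every even
   round [2k] and again [k] steps later. *)
Definition counter (n t : nat) : nat :=
  let k := t %/ n.*2 in let u := t %% n.*2 in if u < k then u else u - k.

Lemma counterE (n k u : nat) :
  u < n.*2 -> counter n (k * n.*2 + u) = if u < k then u else u - k.
Proof.
move=> ltu; rewrite /counter divnMDl ?modnMDl; last by lia.
by rewrite divn_small // modn_small // addn0.
Qed.

Lemma counter_step (n t : nat) : 0 < n -> step (counter n t) (counter n t.+1).
Proof.
move=> n0; have := divn_eq t n.*2.
have ltu : t %% n.*2 < n.*2 by rewrite ltn_mod; lia.
move: (t %/ _) (t %% _) ltu => k u ltu ->.
rewrite -addnS; case: (ltnP u.+1 n.*2) => ltSu.
  by rewrite !counterE // /step; do 2![case: ltnP => ?]; lia.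
have -> : k * n.*2 + u.+1 = k.+1 * n.*2 + 0 by lia.
by rewrite (@counterE _ k.+1) ?double_gt0 //= /step orbT.
Qed.

(** The right side is [n + i - k]. An even round gives at most [j], which is smaller as [k < n]; a
    later odd round gives [n + j - k'] with [k' > k]. *)
Lemma counter_odd_round (n k i r j : nat) :
  k < n -> i < n -> j <= i -> k.*2.+1 < r <= n.*2 ->
  counter n (r * n + j) < counter n (k.*2.+1 * n + i).
Proof.
move=> kn i_n ji /andP[kr rn].
have -> : k.*2.+1 * n + i = k * n.*2 + (n + i) by lia.
rewrite counterE; last by lia.
have Er := odd_double_half r; move: Er; case: (odd r) => Er.
  have -> : r * n + j = r./2 * n.*2 + (n + j) by rewrite -{1}Er; lia.
  by rewrite counterE; [do 2![case: ifP => ?]; lia | lia].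
have -> : r * n + j = r./2 * n.*2 + j by rewrite -{1}Er; lia.
by rewrite counterE; [do 2![case: ifP => ?]; lia | lia].
Qed.

(** The second counter runs one round ahead, so its odd rounds are the even rounds of the first. *)
Definition square_run (n : nat) (v : nat -> nat -> nat) (t l : nat) : nat :=
  match l with
  | 0 => counter n t
  | 1 => counter n (t + n)
  | l'.+2 => v (t %% n) l'
  end.

Lemma cyclic_run_square (d n : nat) (v : nat -> nat -> nat) :
  0 < n -> cyclic_run d n v ->
  cyclic_run d.+2 (2 * n ^ 2) (square_run n v).
Proof.
move=> n0 [st nd].
have EN : 2 * n ^ 2 = n * n.*2 by rewrite -mulnn; lia.
split=> [t l ltt|t t' /andP[tt' t'N]].
  case: l => [|[|l]] /=; last first.
  - by have := st (t %% n) l; rewrite ltn_mod n0 -(addn1 (t %% n)) modnDml addn1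
      modn_dvdm ?EN ?dvdn_mulr //; apply.
  - case: (ltnP t.+1 (2 * n ^ 2)) => ltSt.
      by rewrite modn_small // addSn; exact: counter_step.
    have -> : t.+1 = 2 * n ^ 2 by lia.
    rewrite modnn add0n.
    (* The second counter closes the cycle by an increment, from [n.-1] to [n]. *)
    have -> : t + n = n * n.*2 + n.-1 by lia.
    have -> : counter n n = counter n (0 * n.*2 + n) by [].
    by rewrite !counterE ?ltn0 ?subn0 ?ifT /step; lia.
  - case: (ltnP t.+1 (2 * n ^ 2)) => ltSt.
      by rewrite modn_small //; exact: counter_step.
    have -> : t.+1 = 2 * n ^ 2 by lia.
    by rewrite modnn /counter mod0n sub0n if_same /step orbT.
have lti : t %% n < n by rewrite ltn_mod.
have ltj : t' %% n < n by rewrite ltn_mod.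
case: (ltnP (t %% n) (t' %% n)) => [ij|ji].
  by have [|l ld lt] := nd (t %% n) (t' %% n); [rewrite ij | exists l.+2].
have Et := divn_eq t n; have Et' := divn_eq t' n.
move: (t %/ n) (t %% n) (t' %/ n) (t' %% n) Et Et' lti ltj ji => r i r' j Et Et' lti ltj ji.
have rr' : r < r' by nia.
have r'N : r' < n.*2 by nia.
(* The counter that is in an odd round decreases: the first if [r] is odd, else the second. *)
have Er := odd_double_half r; move: Er; case: (odd r) => Er.
  by exists 0 => //=; rewrite Et Et' -Er; apply: counter_odd_round; lia.
exists 1 => //=.
have -> : t + n = r./2.*2.+1 * n + i by rewrite Et -{1}Er; lia.
have -> : t' + n = r'.+1 * n + j by rewrite Et'; lia.
by apply: counter_odd_round; lia.
Qed.

(** The default 0 of [nth] keeps all coordinates beyond the first two constant. *)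
Lemma cyclic_run4 :
  cyclic_run 2 4
    (fun t => nth 0 (nth [::] [:: [:: 1; 1]; [:: 0; 2]; [:: 1; 0]; [:: 0; 0]] t)).
Proof.
split=> [[|[|[|[|//]]]] [|[|l]] _ //=|]; rewrite ?nth_nil //.
case=> [|[|[|i]]] [|[|[|[|j]]]] //=; rewrite ?andbF // => _; by [exists 0 | exists 1].
Qed.

Lemma cyclic_run_exists (k : nat) :
  exists v, cyclic_run k.+1.*2 (2 ^ (3 * 2 ^ k - 1)) v.
Proof.
elim: k => [|k [v run]]; first by eexists; exact: cyclic_run4.
(* The exponent [e] becomes [2 * e + 1]. *)
have -> : 2 ^ (3 * 2 ^ k.+1 - 1) = 2 * (2 ^ (3 * 2 ^ k - 1)) ^ 2.
  rewrite -expnM -expnS; congr (2 ^ _).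
  by have := expn_gt0 2 k; rewrite expnS; lia.
by eexists; apply: cyclic_run_square run; rewrite expn_gt0.
Qed.

Theorem theorem2 (d : nat) (hd : 2 <= d) :
  L d >= Lcirc d /\ Lcirc d >= 2 ^ (3 * 2 ^ (d %/ 2 - 1) - 1).
Proof.
have [B HB] := size_valid_non_dominating d.
have sub (s : seq (vec d)) :
    cyclic s && non_dominating s -> valid s && non_dominating s.
  by case/andP => /cyclic_valid -> ->.
have [_ maxL] : is_max_length (fun s : seq (vec d) => valid s && non_dominating s) (L d).
  by apply: max_lengthP HB; exists [::].
have [[s Ps szs] maxLc] :
    is_max_length (fun s : seq (vec d) => cyclic s && non_dominating s) (Lcirc d).
  by apply: (@max_lengthP _ _ B) => [|s /sub/HB //]; exists [::].
split; first by rewrite -szs; apply/maxL/sub.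
have [v run] := cyclic_run_exists (d %/ 2 - 1).
have [|s' Ps' <-] := cyclic_run_seq d _ _ _ _ run; first by lia.
exact: maxLc.
Qed.
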